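(* There is no minimal equivariant Chekanov torus in $\mathbb{CP}^2$.
   Context: $\mathbb{CP}^2$ carries the Fubini--Study metric normalised to have Einstein constant $\kappa=6$; a Lagrangian $L$ is monotone if $\kappa\int_D\omega=\pi\mu(D)$ for every disc $D\in\pi_2(\mathbb{CP}^2,L)$ ($\mu$ the Maslov class). For $\gamma\subset\mathbb{C}$ put $L_\gamma=\{[ze^{i\alpha}:ze^{-i\alpha}:1]:z\in\gamma,\ \alpha\in\mathbb{R}\}$; $L_\gamma$ is equivariant if $\gamma=-\gamma$ and $\gamma$ is invariant under complex conjugation. An equivariant Chekanov torus is a monotone equivariant $L_\gamma$ with $\gamma=\gamma_0\cup(-\gamma_0)$, where $\gamma_0\subset\mathbb{C}\setminus\{0\}$ is an embedded closed curve not enclosing $0$ and disjoint from $-\gamma_0$. Minimal means that the mean curvature vector vanishes identically. *)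

(* Defs.v *)
From Stdlib Require Export Reals ZArith.
From Coquelicot Require Export Coquelicot.
From Stdlib Require Import Lra.

Open Scope R_scope.

Definition C2 : Type := (C * C)%type.
Definition C3 : Type := (C * C * C)%type.

Definition cis (t : R) : C := (cos t, sin t).

Definition zero2 : C2 := (RtoC 0, RtoC 0).
Definition add2 (v w : C2) : C2 := (fst v + fst w, snd v + snd w)%C.
Definition scal2 (l : C) (v : C2) : C2 := (l * fst v, l * snd v)%C.
Definition sub2 (v w : C2) : C2 := add2 v (scal2 (RtoC (-1)) w).
(** C-linear in the first argument, as is [herm3]. *)
Definition herm2 (v w : C2) : C :=
  (fst v * Cconj (fst w) + snd v * Cconj (snd w))%C.

Definition zero3 : C3 := (RtoC 0, RtoC 0, RtoC 0).
Definition add3 (v w : C3) : C3 :=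
  let '(v0, v1, v2) := v in let '(w0, w1, w2) := w in
  (v0 + w0, v1 + w1, v2 + w2)%C.
Definition scal3 (l : C) (v : C3) : C3 :=
  let '(v0, v1, v2) := v in (l * v0, l * v1, l * v2)%C.
Definition sub3 (v w : C3) : C3 := add3 v (scal3 (RtoC (-1)) w).
Definition herm3 (v w : C3) : C :=
  let '(v0, v1, v2) := v in let '(w0, w1, w2) := w in
  (v0 * Cconj w0 + v1 * Cconj w1 + v2 * Cconj w2)%C.
Definition norm3 (v : C3) : R := sqrt (Re (herm3 v v)).

Definition smooth1_R (f : R -> R) : Prop := forall n t, ex_derive_n f n t.
Definition smooth1_C (c : R -> C) : Prop :=
  smooth1_R (fun t => Re (c t)) /\ smooth1_R (fun t => Im (c t)).
Definition smooth1_C3 (c : R -> C3) : Prop :=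
  smooth1_C (fun t => fst (fst (c t))) /\
  smooth1_C (fun t => snd (fst (c t))) /\
  smooth1_C (fun t => snd (c t)).

Definition deriv_C (c : R -> C) (t : R) : C :=
  (Derive (fun x => Re (c x)) t, Derive (fun x => Im (c x)) t).
Definition deriv_C2 (c : R -> C2) (t : R) : C2 :=
  (deriv_C (fun x => fst (c x)) t, deriv_C (fun x => snd (c x)) t).
Definition deriv_C3 (c : R -> C3) (t : R) : C3 :=
  (deriv_C (fun x => fst (fst (c x))) t,
   deriv_C (fun x => snd (fst (c x))) t,
   deriv_C (fun x => snd (c x)) t).

Definition smooth2_R (f : R -> R -> R) : Prop := forall n s t, ex_diff_n f n s t.
Definition smooth2_C (f : R -> R -> C) : Prop :=
  smooth2_R (fun s t => Re (f s t)) /\ smooth2_R (fun s t => Im (f s t)).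
Definition smooth2_C2 (f : R -> R -> C2) : Prop :=
  smooth2_C (fun s t => fst (f s t)) /\ smooth2_C (fun s t => snd (f s t)).
Definition smooth2_C3 (F : R -> R -> C3) : Prop :=
  smooth2_C (fun s t => fst (fst (F s t))) /\
  smooth2_C (fun s t => snd (fst (F s t))) /\
  smooth2_C (fun s t => snd (F s t)).

Definition ds_C2 (f : R -> R -> C2) (s t : R) : C2 := deriv_C2 (fun x => f x t) s.
Definition dt_C2 (f : R -> R -> C2) (s t : R) : C2 := deriv_C2 (fun y => f s y) t.
Definition ds_C3 (F : R -> R -> C3) (s t : R) : C3 := deriv_C3 (fun x => F x t) s.
Definition dt_C3 (F : R -> R -> C3) (s t : R) : C3 := deriv_C3 (fun y => F s y) t.

(** A point is a complex line of C^3 with the origin removed, that is, the set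
    of its vectors of homogeneous coordinates. *)
Record CP2 : Type := mkCP2 {
  hcoord : C3 -> Prop;
  hcoord_spec : exists Z, Z <> zero3 /\
    forall W, hcoord W <-> exists l : C, l <> RtoC 0 /\ W = scal3 l Z }.

Definition over (L : CP2 -> Prop) (Z : C3) : Prop := exists p, L p /\ hcoord p Z.

(** Throughout, a smooth map to CP^2 from an interval, a disc or a plane is given
    by a smooth lift to C^3 minus the origin (one exists, the domain being
    contractible), and the tangent space of CP^2 at [Z] is represented by
    C^3 / C Z through the differential at Z of the projection. *)

(** The Fubini-Study metric is the quotient by the Hopf fibration of the round
    metric of the unit sphere of C^3; it has constant holomorphic sectional
    curvature 4, so that Ric = 6 g, and projective lines have area PI. The form
    [fs_herm Z] on C^3 has kernel C Z, and
    [fs_herm (l Z) (l v) (l w) = fs_herm Z v w]. *)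
Definition fs_herm (Z v w : C3) : C :=
  ((herm3 v w * herm3 Z Z - herm3 v Z * herm3 Z w) / (herm3 Z Z * herm3 Z Z))%C.
Definition fs_metric (Z v w : C3) : R := Re (fs_herm Z v w).
(** [fs_omega Z v w = fs_metric Z (i v) w] *)
Definition fs_omega (Z v w : C3) : R := - Im (fs_herm Z v w).

Definition kappa : R := 6.

(** Real linear independence of the classes of [v] and [w] in C^3 / C Z. *)
Definition indep_mod (Z v w : C3) : Prop :=
  forall (a b : R) (c : C),
    add3 (scal3 (RtoC a) v) (scal3 (RtoC b) w) = scal3 c Z -> a = 0 /\ b = 0.

(** The preimage in C^3 of the tangent space of [L] at [Z]. *)
Definition tangent (L : CP2 -> Prop) (Z v : C3) : Prop :=
  exists c : R -> C3,
    smooth1_C3 c /\ (forall t, over L (c t)) /\ c 0 = Z /\ deriv_C3 c 0 = v.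

(** Around each point, [L] is parametrised by an immersion [F] of the plane such
    that the images of the neighbourhoods of the origin are neighbourhoods of
    that point in [L]. *)
Definition embedded_surface (L : CP2 -> Prop) : Prop :=
  forall Z, over L Z -> exists F : R -> R -> C3,
    smooth2_C3 F /\ F 0 0 = Z /\
    (forall s t, over L (F s t)) /\
    (forall s t, indep_mod (F s t) (ds_C3 F s t) (dt_C3 F s t)) /\
    (forall eps, 0 < eps -> exists delta, 0 < delta /\
       forall W, over L W -> norm3 (sub3 W Z) < delta ->
         exists s t l, Rabs s < eps /\ Rabs t < eps /\ W = scal3 l (F s t)).

Definition lagrangian (L : CP2 -> Prop) : Prop :=
  embedded_surface L /\
  forall Z v w, over L Z -> tangent L Z v -> tangent L Z w -> fs_omega Z v w = 0.

Definition in_disc (x y : R) : Prop := x * x + y * y <= 1.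

(** Every class in pi_2(CP^2, L) has such a representative. *)
Definition disc_with_boundary_on (L : CP2 -> Prop) (U : R -> R -> C3) : Prop :=
  smooth2_C3 U /\
  (forall x y, in_disc x y -> U x y <> zero3) /\
  (forall th, over L (U (cos th) (sin th))).

Definition disc_area (U : R -> R -> C3) : R :=
  RInt (fun x =>
    RInt (fun y => fs_omega (U x y) (ds_C3 U x y) (dt_C3 U x y))
         (- sqrt (1 - x * x)) (sqrt (1 - x * x))) (-1) 1.

(** The classes of [E1] and [E2] modulo [U] form a complex frame of the pullback
    of the tangent bundle of CP^2 to the disc. *)
Definition trivialisation (U E1 E2 : R -> R -> C3) : Prop :=
  smooth2_C3 E1 /\ smooth2_C3 E2 /\
  forall x y, in_disc x y -> forall a b c : C,
    add3 (scal3 a (U x y)) (add3 (scal3 b (E1 x y)) (scal3 c (E2 x y))) = zero3 ->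
    a = RtoC 0 /\ b = RtoC 0 /\ c = RtoC 0.

(** Winding number along the boundary of det^2 / |det|^2, where det is the
    determinant, in the frame [E1], [E2], of any real basis of the tangent
    plane of [L]; the quotient does not depend on the basis. *)
Definition maslov_index (L : CP2 -> Prop) (U E1 E2 : R -> R -> C3) (m : Z) : Prop :=
  exists phi : R -> R,
    (forall th, continuous phi th) /\
    phi (2 * PI) - phi 0 = 2 * PI * IZR m /\
    forall th, let x := cos th in let y := sin th in
    forall (v w : C3) (v0 v1 v2 w0 w1 w2 : C),
      tangent L (U x y) v -> tangent L (U x y) w -> indep_mod (U x y) v w ->
      v = add3 (scal3 v0 (U x y)) (add3 (scal3 v1 (E1 x y)) (scal3 v2 (E2 x y))) ->
      w = add3 (scal3 w0 (U x y)) (add3 (scal3 w1 (E1 x y)) (scal3 w2 (E2 x y))) ->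
      let d := (v1 * w2 - v2 * w1)%C in
      (d * d)%C = (RtoC (Cmod d * Cmod d) * cis (phi th))%C.

Definition monotone (L : CP2 -> Prop) : Prop :=
  lagrangian L /\
  forall U E1 E2 m,
    disc_with_boundary_on L U -> trivialisation U E1 E2 ->
    maslov_index L U E1 E2 m ->
    kappa * disc_area U = PI * IZR m.

Inductive chart_index : Set := chart0 | chart1 | chart2.

Definition insert (k : chart_index) (a : C) (z : C2) : C3 :=
  match k with
  | chart0 => (a, fst z, snd z)
  | chart1 => (fst z, a, snd z)
  | chart2 => (fst z, snd z, a)
  end.

(** The Fubini-Study metric in the affine chart [z |-> [insert k 1 z]]. *)
Definition chart_metric (k : chart_index) (z v w : C2) : R :=
  fs_metric (insert k (RtoC 1) z) (insert k (RtoC 0) v) (insert k (RtoC 0) w).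

(** Derivative at [z], in the direction [u], of [g(v, w)] for constant vector
    fields [v] and [w]. *)
Definition d_metric (k : chart_index) (z u v w : C2) : R :=
  Derive (fun h => chart_metric k (add2 z (scal2 (RtoC h) u)) v w) 0.

(** Koszul's formula: [g(nabla_u v, w)] for constant vector fields. *)
Definition christoffel1 (k : chart_index) (z u v w : C2) : R :=
  (d_metric k z u v w + d_metric k z v u w - d_metric k z w u v) / 2.

(** The vector dual to a real linear form for [chart_metric k z]: see [metric_sharpP]. *)
Definition metric_sharp (z : C2) (xi : C2 -> R) : C2 :=
  let x : C2 := ((xi (RtoC 1, RtoC 0), xi (Ci, RtoC 0)),
                 (xi (RtoC 0, RtoC 1), xi (RtoC 0, Ci))) in
  scal2 (RtoC 1 + herm2 z z)%C (add2 x (scal2 (herm2 x z) z)).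

Definition christoffel (k : chart_index) (z u v : C2) : C2 :=
  metric_sharp z (christoffel1 k z u v).

Lemma fs_metricE (Z v w : C3) : let n := Re (herm3 Z Z) in
  n <> 0 ->
  fs_metric Z v w =
  (Re (herm3 v w) * n - Re (herm3 v Z * herm3 Z w)%C) / (n * n).
Proof.
intros n Hn.
assert (HZ : herm3 Z Z = RtoC n).
{ unfold n; destruct Z as [[[a b] [c d]] [e f]].
  unfold herm3, Cconj, Cplus, Cmult, Re, Im, RtoC; simpl; f_equal; ring. }
unfold fs_metric, fs_herm; rewrite HZ; clearbody n.
generalize (herm3 v w) (herm3 v Z * herm3 Z w)%C; intros [a b] [c d].
unfold Cdiv, Cinv, Cminus, Copp, Cplus, Cmult, Re, Im, RtoC; simpl.
field; exact Hn.
Qed.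

Lemma chart_metricE (k : chart_index) (z v w : C2) :
  let n := 1 + Re (herm2 z z) in
  chart_metric k z v w =
  (Re (herm2 v w) * n - Re (herm2 v z * herm2 z w)%C) / (n * n).
Proof.
intro n.
assert (H11 : Re (herm3 (insert k (RtoC 1) z) (insert k (RtoC 1) z)) = n).
{ unfold n; destruct z as [[a b] [c d]], k;
  unfold insert, herm3, herm2, Cconj, Cplus, Cmult, Re, Im, RtoC; simpl; ring. }
assert (H : forall (a : R) x y,
    herm3 (insert k (RtoC 0) x) (insert k (RtoC a) y) = herm2 x y /\
    herm3 (insert k (RtoC a) x) (insert k (RtoC 0) y) = herm2 x y).
{ intros e [[x0 x1] [x2 x3]] [[y0 y1] [y2 y3]]; destruct k;
  unfold insert, herm3, herm2, Cconj, Cplus, Cmult, Re, Im, RtoC; simpl;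
  split; f_equal; ring. }
assert (Hn : 0 < n).
{ unfold n; destruct z as [[a b] [c d]].
  unfold herm2, Cconj, Cplus, Cmult, Re, Im; simpl; nra. }
unfold chart_metric; rewrite fs_metricE; rewrite H11; [|now apply Rgt_not_eq].
now rewrite (proj1 (H 0 v w)), (proj1 (H 1 v z)), (proj2 (H 1 z w)).
Qed.

Lemma herm2_lin (l : C) (x y w : C2) :
  herm2 (scal2 l (add2 x y)) w = (l * (herm2 x w + herm2 y w))%C.
Proof. unfold herm2, scal2, add2; simpl; ring. Qed.

Lemma herm2_scal (l : C) (x w : C2) : herm2 (scal2 l x) w = (l * herm2 x w)%C.
Proof. unfold herm2, scal2; simpl; ring. Qed.

Lemma metric_sharpP (k : chart_index) (z : C2) (xi : C2 -> R)
  (xi_add : forall v w, xi (add2 v w) = xi v + xi w)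
  (xi_scal : forall (a : R) v, xi (scal2 (RtoC a) v) = a * xi v) (w : C2) :
  chart_metric k z (metric_sharp z xi) w = xi w.
Proof.
assert (Hw : xi w = Re (fst w) * xi (RtoC 1, RtoC 0) + Im (fst w) * xi (Ci, RtoC 0)
   + (Re (snd w) * xi (RtoC 0, RtoC 1) + Im (snd w) * xi (RtoC 0, Ci))).
{ rewrite <- !xi_scal, <- !xi_add. f_equal.
  destruct w as [[a b] [c d]].
  unfold add2, scal2, Ci, Re, Im, Cplus, Cmult, RtoC; simpl.
  f_equal; f_equal; ring. }
rewrite Hw, chart_metricE; unfold metric_sharp; clear Hw xi_add xi_scal.
cbv zeta; rewrite !herm2_lin, !herm2_scal.
generalize (xi (RtoC 1, RtoC 0)) (xi (Ci, RtoC 0)) (xi (RtoC 0, RtoC 1)) (xi (RtoC 0, Ci)).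
intros p q r u.
set (x := ((p, q), (r, u)) : C2).
replace (Re (fst w) * _ + _ + _) with (Re (herm2 x w)).
2: { destruct w as [[a b] [c d]].
  unfold x, herm2, Cconj, Cplus, Cmult, Re, Im; simpl; ring. }
assert (Hz : exists m, 0 <= m /\ herm2 z z = RtoC m).
{ destruct z as [[a b] [c d]]; exists (a * a + b * b + (c * c + d * d)).
  split; [nra|].
  unfold herm2, Cconj, Cplus, Cmult, Re, Im, RtoC; simpl; f_equal; ring. }
destruct Hz as [m [Hm ->]].
destruct (herm2 x w) as [a b], (herm2 x z) as [c d], (herm2 z w) as [e f].
unfold Cplus, Cmult, Re, RtoC; simpl.
field; apply Rgt_not_eq; lra.
Qed.

(** [mean_curvature k f s t] is the trace of the second fundamental form of the
    immersed surface [f] in the chart [k]: [gss], [gst], [gtt] is the first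
    fundamental form, [tang] the orthogonal projection to the tangent plane and
    [II_ab] the normal part of [nabla_a (d_b f)]. *)
Definition mean_curvature (k : chart_index) (f : R -> R -> C2) (s t : R) : C2 :=
  let z := f s t in
  let g := chart_metric k z in
  let fs := ds_C2 f s t in
  let ft := dt_C2 f s t in
  let gss := g fs fs in
  let gst := g fs ft in
  let gtt := g ft ft in
  let det := gss * gtt - gst * gst in
  let tang := fun v =>
    add2 (scal2 (RtoC ((gtt * g v fs - gst * g v ft) / det)) fs)
         (scal2 (RtoC ((gss * g v ft - gst * g v fs) / det)) ft) in
  let nor := fun v => sub2 v (tang v) in
  let IIss := nor (add2 (ds_C2 (ds_C2 f) s t) (christoffel k z fs fs)) in
  let IIst := nor (add2 (ds_C2 (dt_C2 f) s t) (christoffel k z fs ft)) in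
  let IItt := nor (add2 (dt_C2 (dt_C2 f) s t) (christoffel k z ft ft)) in
  add2 (scal2 (RtoC (gtt / det)) IIss)
       (add2 (scal2 (RtoC (- 2 * gst / det)) IIst)
             (scal2 (RtoC (gss / det)) IItt)).

(** The mean curvature vector of the surface [L] vanishes identically: it does so
    in every local parametrisation of [L] in every affine chart. *)
Definition minimal (L : CP2 -> Prop) : Prop :=
  forall (k : chart_index) (f : R -> R -> C2),
    smooth2_C2 f ->
    (forall s t, over L (insert k (RtoC 1) (f s t))) ->
    (forall s t (a b : R),
       add2 (scal2 (RtoC a) (ds_C2 f s t)) (scal2 (RtoC b) (dt_C2 f s t)) = zero2 ->
       a = 0 /\ b = 0) ->
    forall s t, mean_curvature k f s t = zero2.

Definition L_of (gamma : C -> Prop) (p : CP2) : Prop :=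
  exists (z : C) (alpha : R),
    gamma z /\ hcoord p (z * cis alpha, z * cis (- alpha), RtoC 1)%C.

Definition equivariant (gamma : C -> Prop) : Prop :=
  (forall z, gamma z <-> gamma (- z)%C) /\ (forall z, gamma z <-> gamma (Cconj z)).

Definition embedded_closed_curve (gamma : C -> Prop) : Prop :=
  exists c : R -> C,
    smooth1_C c /\
    (forall t, c (t + 1) = c t) /\
    (forall t, deriv_C c t <> RtoC 0) /\
    (forall s t, 0 <= s < 1 -> 0 <= t < 1 -> c s = c t -> s = t) /\
    (forall z, gamma z <-> exists t, c t = z).

(** [z] lies in a bounded component of the complement of [gamma]. *)
Definition encloses (gamma : C -> Prop) (z : C) : Prop :=
  ~ gamma z /\
  exists M : R, forall p : R -> C,
    (forall t, continuous p t) ->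
    p 0 = z -> (forall t, 0 <= t <= 1 -> ~ gamma (p t)) ->
    Cmod (p 1) <= M.

Definition equivariant_Chekanov_torus (L : CP2 -> Prop) : Prop :=
  exists gamma gamma0 : C -> Prop,
    L = L_of gamma /\
    monotone L /\
    equivariant gamma /\
    (forall z, gamma z <-> gamma0 z \/ gamma0 (- z)%C) /\
    embedded_closed_curve gamma0 /\
    ~ gamma0 (RtoC 0) /\
    ~ encloses gamma0 (RtoC 0) /\
    (forall z, gamma0 z -> ~ gamma0 (- z)%C).

(* Main.v *)
Require Import Defs.
From Stdlib Require Import Reals Lra Classical FunctionalExtensionality.
From Coquelicot Require Import Coquelicot.

(** Minimality of [L_gamma] says that [gamma] is a geodesic of a rotationally
    symmetric metric on C \ {0}: the orbit length [r / sqrt (1 + 2 r^2)] times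
    the quotient line element [|dz| / (1 + 2 r^2)]. Clairaut's integral of a closed
    geodesic cannot vanish, since it does not at a critical point of [r]; hence the
    polar angle is strictly monotone along [gamma0], and the winding number of
    [gamma0] around 0 is not zero. But if 0 is not enclosed, it can be moved off to
    infinity in the complement of [gamma0] without changing the winding number,
    which is therefore zero. *)

(** * Christoffel symbols of the Fubini-Study metric in an affine chart *)

(** Along the line [z + h u] the metric coefficient is a quotient of polynomials in [h]. Writing
    both in Horner form exposes the terms of order 0 and 1, which alone determine the derivative at
    [h = 0]. *)
Lemma d_metricE (k : chart_index) (z u v w : C2) :
  let n := 1 + Re (herm2 z z) in
  d_metric k z u v w =
  - (2 * Re (herm2 u z)* Re (herm2 v w)
     + Re (herm2 v u * herm2 z w + herm2 v z * herm2 u w)%C) / n ^ 2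
  + 4 * Re (herm2 u z) * Re (herm2 v z * herm2 z w)%C / n ^ 3.
Proof.
intro n; unfold d_metric.
assert (Hn : 0 < n).
{ unfold n; destruct z as [[a b] [c d]].
  unfold herm2, Cconj, Cplus, Cmult, Re, Im; simpl; nra. }
rewrite (Derive_ext _ (fun h =>
  (Re (herm2 v w) * (n + h * (2 * Re (herm2 u z) + h * Re (herm2 u u)))
   - (Re (herm2 v z * herm2 z w)%C
      + h * (Re (herm2 v u * herm2 z w + herm2 v z * herm2 u w)%C
             + h * Re (herm2 v u * herm2 u w)%C)))
  / (n + h * (2 * Re (herm2 u z) + h * Re (herm2 u u))) ^ 2)).
2: { intro h; rewrite chart_metricE; unfold n.
  destruct z as [[a b] [c d]], u as [[u0 u1] [u2 u3]], v as [[v0 v1] [v2 v3]], w as [[w0 w1] [w2 w3]].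
  unfold herm2, add2, scal2, Cconj, Cplus, Cmult, Re, Im, RtoC; simpl.
  unfold Rdiv; f_equal; [|f_equal]; ring. }
generalize (Re (herm2 v w)) (Re (herm2 u z)) (Re (herm2 u u))
  (Re (herm2 v z * herm2 z w)%C) (Re (herm2 v u * herm2 z w + herm2 v z * herm2 u w)%C)
  (Re (herm2 v u * herm2 u w)%C).
intros; apply is_derive_unique; auto_derive.
- rewrite !Rmult_0_l, !Rplus_0_r, ?Rmult_1_r; apply Rgt_not_eq; apply Rmult_lt_0_compat; lra.
- field; lra.
Qed.

(** [metric_sharp] assembles a vector from the values of the form on the standard real basis; for a
    form given as a real Hermitian pairing with [X], that vector is [X] itself. *)
Lemma metric_sharp_herm2 (z X : C2) :
  metric_sharp z (fun w => Re (herm2 X w)) =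
  scal2 (1 + herm2 z z)%C (add2 X (scal2 (herm2 X z) z)).
Proof.
unfold metric_sharp; cbv zeta.
replace (_, _) with X; [reflexivity|].
destruct X as [[a b] [c d]].
unfold herm2, Ci, Cconj, Cplus, Cmult, Re, Im, RtoC; simpl.
f_equal; f_equal; ring.
Qed.

(** Koszul's formula, arranged as a real Hermitian pairing with an explicit vector so that
    [metric_sharp_herm2] yields its dual. *)
Lemma christoffel1E (k : chart_index) (z u v w : C2) :
  let r := RtoC (/ (1 + Re (herm2 z z))) in
  christoffel1 k z u v w =
  Re (herm2 (add2 (scal2 (- (r * r)) (add2 (scal2 (herm2 u z) v) (scal2 (herm2 v z) u)))
                  (scal2 (2 * r * r * r * herm2 u z * herm2 v z) z)) w)%C.
Proof.
intro r; unfold christoffel1; rewrite !d_metricE.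
unfold Rdiv; rewrite <- !pow_inv.
assert (Hc : forall x y, herm2 x y = Cconj (herm2 y x)).
{ intros [[x0 x1] [x2 x3]] [[y0 y1] [y2 y3]].
  unfold herm2, Cconj, Cplus, Cmult; simpl; f_equal; ring. }
assert (Ha : forall x y, herm2 (add2 x y) w = (herm2 x w + herm2 y w)%C)
  by (intros; unfold herm2, add2; simpl; ring).
rewrite Ha, !herm2_scal, Ha, !herm2_scal.
rewrite (Hc z v), (Hc z w), (Hc u v), (Hc w v).
unfold r; clear r; generalize (/ (1 + Re (herm2 z z))); intro r.
generalize (herm2 u z) (herm2 v z) (herm2 w z) (herm2 v u) (herm2 u w) (herm2 v w).
intros [a b] [c d] [e f] [g h] [i j] [k' l].
unfold Copp, Cconj, Cplus, Cmult, Re, Im, RtoC; simpl.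
field.
Qed.

(** Taking the dual adds a multiple of [z] that cancels the term of [christoffel1E] along [z]. What
    remains is complex bilinear in [u] and [v], as for every Kaehler metric in holomorphic
    coordinates. *)
Lemma christoffelE (k : chart_index) (z u v : C2) :
  christoffel k z u v =
  scal2 (- / (1 + herm2 z z))%C
    (add2 (scal2 (herm2 u z) v) (scal2 (herm2 v z) u)).
Proof.
assert (Hn : 0 < 1 + Re (herm2 z z)).
{ destruct z as [[a b] [c d]].
  unfold herm2, Cconj, Cplus, Cmult, Re, Im; simpl; nra. }
assert (HZ : herm2 z z = RtoC (1 + Re (herm2 z z) - 1)).
{ destruct z as [[a b] [c d]].
  unfold herm2, Cconj, Cplus, Cmult, Re, Im, RtoC; simpl; f_equal; ring. }
assert (Hx : christoffel1 k z u v = fun w => christoffel1 k z u v w) by reflexivity.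
unfold christoffel; rewrite Hx; clear Hx.
rewrite (functional_extensionality _ _ (christoffel1E k z u v)).
rewrite metric_sharp_herm2.
set (n := 1 + Re (herm2 z z)) in *; clearbody n.
assert (Hne : RtoC n <> RtoC 0) by (intro H; apply RtoC_inj in H; lra).
rewrite RtoC_inv by lra.
assert (H : forall l m x y, herm2 (add2 (scal2 l x) (scal2 m y)) z
   = (l * herm2 x z + m * herm2 y z)%C) by (intros; unfold herm2, add2, scal2; simpl; ring).
rewrite !H, HZ, RtoC_minus.
generalize (herm2 u z) (herm2 v z); intros hu hv.
destruct z as [z0 z1], u as [u0 u1], v as [v0 v1].
unfold add2, scal2; simpl.
replace (1 + (n - 1))%C with (RtoC n) by ring.
f_equal; field; exact Hne.
Qed.

(** * Smoothness and partial derivatives of the torus parametrisation *)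

Lemma smooth1_R_Derive (f : R -> R) : smooth1_R f -> smooth1_R (Derive f).
Proof.
intros Hf [|n] t; [exact I|].
apply ex_derive_ext with (Derive_n f (n + 1)).
- intro u; symmetry; apply (Derive_n_comp f n 1 u).
- exact (Hf (S (n + 1)) t).
Qed.

(** The span of [cos] and [sin] is stable under differentiation, so every iterated derivative stays
    in it. *)
Lemma smooth1_R_trig (a b : R) : smooth1_R (fun t => a * cos t + b * sin t).
Proof.
assert (H : forall n, exists a' b', forall t,
    Derive_n (fun t => a * cos t + b * sin t) n t = a' * cos t + b' * sin t).
{ induction n as [|n [a' [b' IH]]]; [now exists a, b|].
  exists b', (- a'); intro t; simpl.
  rewrite (Derive_ext _ _ _ IH).
  apply is_derive_unique; auto_derive; [exact I|ring]. }
intros [|n] t; [exact I|].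
destruct (H n) as [a' [b' Hn]]; simpl.
apply ex_derive_ext with (fun t => a' * cos t + b' * sin t).
- intro u; symmetry; apply Hn.
- auto_derive; exact I.
Qed.

Lemma smooth1_R_ex_derive (f : R -> R) (t : R) : smooth1_R f -> ex_derive f t.
Proof. intro Hf; exact (Hf 1%nat t). Qed.

(** The real and imaginary parts of [c s * cis t] are two-term sums of this kind. Both partial
    derivatives keep the form, so the induction on the order is made for all four factors at
    once. *)
Lemma smooth2_R_separable (f1 f2 g1 g2 : R -> R) :
  smooth1_R f1 -> smooth1_R f2 -> smooth1_R g1 -> smooth1_R g2 ->
  smooth2_R (fun s t => f1 s * g1 t + f2 s * g2 t).
Proof.
intros F1 F2 G1 G2 n; revert f1 f2 g1 g2 F1 F2 G1 G2.
induction n as [|n IH]; intros f1 f2 g1 g2 F1 F2 G1 G2 s t;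
assert (Hc : continuity_2d_pt (fun s t => f1 s * g1 t + f2 s * g2 t) s t).
1, 3: apply continuity_2d_pt_plus; apply continuity_2d_pt_mult;
  (apply continuity_1d_2d_pt_comp;
   [apply continuity_pt_filterlim; apply @ex_derive_continuous; now apply smooth1_R_ex_derive
   |apply continuity_2d_pt_id1 || apply continuity_2d_pt_id2]).
- split; [exact Hc|exact I].
- split; [exact Hc|].
  assert (Df1 := fun u => smooth1_R_ex_derive f1 u F1).
  assert (Df2 := fun u => smooth1_R_ex_derive f2 u F2).
  assert (Dg1 := fun u => smooth1_R_ex_derive g1 u G1).
  assert (Dg2 := fun u => smooth1_R_ex_derive g2 u G2).
  repeat split.
  + auto_derive; auto.
  + auto_derive; auto.
  + apply ex_diff_n_ext_loc with (fun s t => Derive f1 s * g1 t + Derive f2 s * g2 t).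
    * exists (mkposreal 1 Rlt_0_1); intros u v _ _; symmetry.
      apply is_derive_unique; auto_derive; [auto|now rewrite !Rmult_1_l].
    * apply IH; auto using smooth1_R_Derive.
  + apply ex_diff_n_ext_loc with (fun s t => f1 s * Derive g1 t + f2 s * Derive g2 t).
    * exists (mkposreal 1 Rlt_0_1); intros u v _ _; symmetry.
      apply is_derive_unique; auto_derive; [auto|now rewrite !Rmult_1_l].
    * apply IH; auto using smooth1_R_Derive.
Qed.

(** Two independent profiles, so that the partial derivatives of an [orbit] are
    again of this form. *)
Definition orbit (c e : R -> C) (s t : R) : C2 :=
  (c s * cis t, e s * cis (- t))%C.

Lemma smooth2_C_rotate (c : R -> C) (k : R) (hk : k = 1 \/ k = -1) :
  smooth1_C c -> smooth2_C (fun s t => c s * cis (k * t))%C.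
Proof.
assert (Hcos : smooth1_R (fun t => cos (k * t))).
{ intros n t; apply ex_derive_n_ext with (fun t => 1 * cos t + 0 * sin t).
  - intro u; destruct hk as [-> | ->].
    + rewrite !Rmult_1_l; ring.
    + replace (-1 * u) with (- u) by ring; rewrite cos_neg; ring.
  - apply smooth1_R_trig. }
assert (Hsin : forall a, smooth1_R (fun t => a * sin (k * t))).
{ intros a n t; apply ex_derive_n_ext with (fun t => 0 * cos t + (a * k) * sin t).
  - intro u; destruct hk as [-> | ->].
    + rewrite !Rmult_1_l; ring.
    + replace (-1 * u) with (- u) by ring; rewrite sin_neg; ring.
  - apply smooth1_R_trig. }
intros [Hx Hy]; split; intros n s t.
- apply ex_diff_n_ext_loc with
    (fun s t => Re (c s) * cos (k * t) + Im (c s) * (-1 * sin (k * t))).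
  + exists (mkposreal 1 Rlt_0_1); intros u v _ _; simpl; unfold Re, Im; ring.
  + apply smooth2_R_separable; auto.
- apply ex_diff_n_ext_loc with
    (fun s t => Re (c s) * (1 * sin (k * t)) + Im (c s) * cos (k * t)).
  + exists (mkposreal 1 Rlt_0_1); intros u v _ _; simpl; unfold Re, Im; ring.
  + apply smooth2_R_separable; auto.
Qed.

Lemma smooth2_C2_orbit (c e : R -> C) :
  smooth1_C c -> smooth1_C e -> smooth2_C2 (orbit c e).
Proof.
intros Hc He; split; simpl.
- replace (fun s t => (c s * cis t)%C) with (fun s t => (c s * cis (1 * t))%C).
  + apply smooth2_C_rotate; auto.
  + do 2 (apply functional_extensionality; intro); now rewrite Rmult_1_l.
- replace (fun s t => (e s * cis (- t))%C) with (fun s t => (e s * cis (-1 * t))%C).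
  + apply smooth2_C_rotate; auto.
  + do 2 (apply functional_extensionality; intro); do 2 f_equal; ring.
Qed.

Lemma deriv_C_mult_const (c : R -> C) (l : C) (t : R) :
  smooth1_C c -> deriv_C (fun x => c x * l)%C t = (deriv_C c t * l)%C.
Proof.
intros [H1 H2].
assert (D1 := smooth1_R_ex_derive _ t H1).
assert (D2 := smooth1_R_ex_derive _ t H2).
assert (H : forall (f g : R -> R) a b, ex_derive f t -> ex_derive g t ->
  Derive (fun x => f x * a + g x * b) t = Derive f t * a + Derive g t * b).
{ intros f g a b Hf Hg; apply is_derive_unique; auto_derive; [auto|now rewrite !Rmult_1_l]. }
destruct l as [a b]; unfold deriv_C, Cmult; simpl.
f_equal.
- unfold Rminus; rewrite Ropp_mult_distr_r.
  rewrite <- (H (fun x => Re (c x)) (fun x => Im (c x)) a (- b) D1 D2).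
  apply Derive_ext; intro x; unfold Re, Im; ring.
- exact (H (fun x => Re (c x)) (fun x => Im (c x)) b a D1 D2).
Qed.

Lemma ds_orbit (c e : R -> C) :
  smooth1_C c -> smooth1_C e ->
  ds_C2 (orbit c e) = orbit (deriv_C c) (deriv_C e).
Proof.
intros Hc He; do 2 (apply functional_extensionality; intro).
unfold ds_C2, deriv_C2, orbit; simpl.
now rewrite !deriv_C_mult_const.
Qed.

Lemma dt_orbit (c e : R -> C) :
  dt_C2 (orbit c e) = orbit (fun s => Ci * c s)%C (fun s => - (Ci * e s))%C.
Proof.
do 2 (apply functional_extensionality; intro).
unfold dt_C2, deriv_C2, orbit, deriv_C, cis, Cmult, Copp, Ci, Re, Im; simpl.
f_equal; f_equal; apply is_derive_unique; auto_derive; auto; ring.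
Qed.

Lemma smooth1_C_deriv (c : R -> C) : smooth1_C c -> smooth1_C (deriv_C c).
Proof. intros [H1 H2]; split; now apply smooth1_R_Derive. Qed.

Lemma orbit_0 (c e : R -> C) (s : R) : orbit c e s 0 = (c s, e s).
Proof.
unfold orbit, cis; rewrite Ropp_0, cos_0, sin_0.
destruct (c s), (e s); unfold Cmult; simpl; f_equal; f_equal; ring.
Qed.

(** * Mean curvature of the torus as an equation on the profile curve *)

Definition cross (z w : C) : R := Re z * Im w - Im z * Re w.
Definition sqn (z : C) : R := Re z * Re z + Im z * Im z.

Lemma sqn_pos (z : C) : z <> RtoC 0 -> 0 < sqn z.
Proof.
intro Hz; destruct z as [x y]; unfold sqn, Re, Im; simpl.
destruct (Req_dec x 0) as [-> | Hx]; [|nra].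
destruct (Req_dec y 0) as [-> | Hy]; [now destruct Hz|nra].
Qed.

(** Pairing with [cross z] kills the tangential part along [(z, z)]; the coefficients
    [q], [m], [m'] vanish for the torus by the symmetry exchanging the coordinates. *)
Lemma symmetric_normal_cross (p q r l l' m m' : R) (z w A B : C) (Y : C2) :
  q = 0 -> m = 0 -> m' = 0 ->
  add2 (scal2 (RtoC p) (sub2 (A, A) (add2 (scal2 (RtoC l) (z, z))
                                          (scal2 (RtoC m) (w, (- w)%C)))))
       (add2 (scal2 (RtoC q) Y)
             (scal2 (RtoC r) (sub2 (B, B) (add2 (scal2 (RtoC l') (z, z))
                                          (scal2 (RtoC m') (w, (- w)%C))))))
    = zero2 ->
  p * cross z A + r * cross z B = 0.
Proof.
intros -> -> -> H.
destruct z as [z0 z1], w as [w0 w1], A as [a0 a1], B as [b0 b1], Y as [[] []].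
unfold sub2, add2, scal2, zero2, RtoC, Copp, Cplus, Cmult in H; simpl in H.
injection H; clear H; intros _ _ H1 H0.
unfold cross, Re, Im; simpl.
assert (E := f_equal2 (fun u v => z0 * u - z1 * v) H1 H0); simpl in E.
rewrite !Rmult_0_r, Rminus_0_r in E; rewrite <- E; ring.
Qed.

(** At [t = 0] the base point is [(z, z)] and the tangent plane is spanned by [(z1, z1)] and
    [(i z, - i z)], where [z1] is the velocity of [c]. These are orthogonal, so the trace reduces to
    the two diagonal terms, both along the diagonal of C^2. The resulting equation is that of the
    geodesics, in any parametrisation, of the metric [rho / (1 + 2 rho)^3 |dz|^2], with
    [rho = |z|^2]. *)
Lemma mean_curvature_orbit (c : R -> C) (s : R) :
  smooth1_C c -> c s <> RtoC 0 -> deriv_C c s <> RtoC 0 ->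
  mean_curvature chart2 (orbit c c) s 0 = zero2 ->
  let c1 := deriv_C c s in let c2 := deriv_C (deriv_C c) s in
  (1 + 2 * sqn (c s)) * sqn (c s) * cross c1 c2 =
  sqn c1 * cross (c s) c1 * (4 * sqn (c s) - 1).
Proof.
intros Hc Hz0 Hz1 H.
unfold mean_curvature in H.
rewrite (ds_orbit c c Hc Hc), (ds_orbit (deriv_C c) (deriv_C c)), !dt_orbit in H;
  try apply smooth1_C_deriv, Hc.
rewrite !orbit_0 in H.
(* The mixed second derivative can be abstracted: its coefficient contains [gst], which vanishes by
   [Hsym]. *)
revert H; generalize (ds_C2 (orbit (fun s0 => (Ci * c s0)%C) (fun s0 => (- (Ci * c s0))%C)) s 0).
intros X H c1 c2; fold c1 c2 in H.
unfold c1, c2 in *; clear c1 c2.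
assert (Hrho := sqn_pos _ Hz0); assert (HN := sqn_pos _ Hz1); clear Hz0 Hz1.
revert H Hrho HN; generalize (c s) (deriv_C c s) (deriv_C (deriv_C c) s); intros z z1 z2 H Hrho HN.
set (g := chart_metric chart2 (z, z)) in *.
set (fs := (z1, z1) : C2) in *.
set (ft := ((Ci * z)%C, (- (Ci * z))%C) : C2) in *.
assert (Hnn : Re (herm2 (z, z) (z, z)) = 2 * sqn z).
{ destruct z; unfold sqn, herm2, Cconj, Cplus, Cmult, Re, Im; simpl; ring. }
(* Exchanging the two coordinates is an isometry that fixes [(z, z)] and [(v, v)] and negates
   [ft]. *)
assert (Hsym : forall v, g (v, v) ft = 0).
{ intro v; unfold g; rewrite chart_metricE; unfold ft.
  replace (herm2 (v, v) _) with (RtoC 0).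
  - replace (herm2 (z, z) (_ * _, _))%C with (RtoC 0); [rewrite Cmult_0_r; simpl; unfold Rdiv; ring|].
    destruct z; unfold herm2, Ci, Cconj, Copp, Cplus, Cmult, RtoC; simpl; f_equal; ring.
  - destruct z, v; unfold herm2, Ci, Cconj, Copp, Cplus, Cmult, RtoC; simpl; f_equal; ring. }
assert (Hss : g fs fs = 2 * sqn z1 / (1 + 2 * sqn z) ^ 2).
{ unfold g; rewrite chart_metricE, Hnn.
  replace (Re (herm2 fs fs)) with (2 * sqn z1).
  replace (Re (herm2 fs (z, z) * herm2 (z, z) fs)%C) with (4 * sqn z1 * sqn z).
  - field; lra.
  - unfold fs; destruct z, z1; unfold sqn, herm2, Cconj, Cplus, Cmult, Re, Im; simpl; ring.
  - unfold fs; destruct z, z1; unfold sqn, herm2, Cconj, Cplus, Cmult, Re, Im; simpl; ring. }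
assert (Htt : g ft ft = 2 * sqn z / (1 + 2 * sqn z)).
{ unfold g; rewrite chart_metricE, Hnn.
  replace (Re (herm2 ft ft)) with (2 * sqn z).
  replace (Re (herm2 ft (z, z) * herm2 (z, z) ft)%C) with 0.
  - field; lra.
  - unfold ft; destruct z; unfold sqn, herm2, Ci, Copp, Cconj, Cplus, Cmult, Re, Im; simpl; ring.
  - unfold ft; destruct z; unfold sqn, herm2, Ci, Copp, Cconj, Cplus, Cmult, Re, Im; simpl; ring. }
assert (Gs : add2 (z2, z2) (christoffel chart2 (z, z) fs fs) =
   let a := (z2 - 4 * (z1 * z1 * Cconj z) / RtoC (1 + 2 * sqn z))%C in (a, a)).
{ rewrite christoffelE.
  replace (1 + herm2 (z, z) (z, z))%C with (RtoC (1 + 2 * sqn z)).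
  - unfold herm2, fs, add2, scal2, Cdiv; simpl; f_equal; ring.
  - destruct z; unfold sqn, herm2, Cconj, Cplus, Cmult, RtoC, Re, Im; simpl; f_equal; ring. }
(* [ft] is Hermitian-orthogonal to [(z, z)], so its Christoffel term is zero and only the Euclidean
   acceleration of the orbit is left. *)
assert (Gt : add2 ((Ci * (Ci * z))%C, (- (Ci * - (Ci * z)))%C) (christoffel chart2 (z, z) ft ft) =
   let a := (- z)%C in (a, a)).
{ rewrite christoffelE.
  replace (herm2 ft (z, z)) with (RtoC 0).
  - unfold add2, scal2; simpl.
    generalize (/ (1 + herm2 (z, z) (z, z)))%C; intro r.
    f_equal; destruct z, r, ft as [[] []]; unfold Ci, Copp, Cplus, Cmult, RtoC; simpl; f_equal; ring.
  - unfold ft; destruct z; unfold herm2, Ci, Copp, Cconj, Cplus, Cmult, RtoC; simpl; f_equal; ring. }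
rewrite Gs, Gt in H; clear Gs Gt.
cbv zeta in H.
rewrite (Hsym z1 : g fs ft = 0), !Hsym, Hss, Htt in H.
clear Hsym Hss Htt Hnn.
apply symmetric_normal_cross in H; [|unfold Rdiv; ring ..].
replace (cross z1 (- z)%C) with (cross z z1) in H
  by (destruct z, z1; unfold cross, Copp; simpl; ring).
replace (cross z1 (z2 - _)%C)
  with (cross z1 z2 - 4 * sqn z1 * cross z z1 / (1 + 2 * sqn z)) in H.
2: { unfold Cdiv; rewrite <- RtoC_inv by lra; unfold Rdiv; generalize (/ (1 + 2 * sqn z)); intro r.
  destruct z, z1, z2; unfold cross, sqn, Cminus, Copp, Cplus, Cmult, Cconj; simpl; ring. }
revert H Hrho HN.
generalize (sqn z) (sqn z1) (cross z1 z2) (cross z z1); intros rho N k J H Hrho HN.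
apply Rminus_diag_uniq.
(* The coefficients in [H] reduce to [1 / gss] and [1 / gtt]; this factor clears their
   denominators. *)
transitivity ((2 * N * rho / (1 + 2 * rho)) * 0); [|ring].
rewrite <- H; field; repeat split; nra.
Qed.

(** * Minimality applied to the parametrisation of [L_of gamma] *)

Lemma Cmult_integral (z w : C) : (z * w)%C = RtoC 0 -> z = RtoC 0 \/ w = RtoC 0.
Proof.
intro H; apply NNPP; intro Hn; apply not_or_and in Hn.
now apply (Cmult_neq_0 z w).
Qed.

Lemma Cmult_cis_eq0 (z : C) (t : R) : (z * cis t)%C = RtoC 0 -> z = RtoC 0.
Proof.
intro H; destruct (Cmult_integral _ _ H) as [Hz | Hz]; [exact Hz|].
exfalso; injection Hz; intros Hs Hc.
assert (E := sin2_cos2 t); rewrite Hs, Hc in E; unfold Rsqr in E; lra.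
Qed.

(** The required point of [CP2] is built as the punctured line through [Z], which is nonzero because
    its last coordinate is 1. *)
Lemma over_L_of (gamma : C -> Prop) (z : C) (t : R) :
  gamma z -> over (L_of gamma) (z * cis t, z * cis (- t), RtoC 1)%C.
Proof.
intro Hz; set (Z := (_, _) : C3).
assert (HZ0 : Z <> zero3) by (intro E; injection E; lra).
assert (HZ : hcoord (mkCP2 (fun W => exists l : C, l <> RtoC 0 /\ W = scal3 l Z)
    (ex_intro _ Z (conj HZ0 (fun W => iff_refl _)))) Z).
{ exists (RtoC 1); split; [apply C1_nz|].
  unfold Z, scal3; now rewrite !Cmult_1_l. }
eexists; split; [|exact HZ].
exists z, t; split; [exact Hz|exact HZ].
Qed.

(** Once the unit factors [cis t] and [cis (- t)] are removed, the two coordinates of the relation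
    differ only in the sign of the [b] term. Their sum isolates [a] and their difference isolates
    [b]. *)
Lemma orbit_immersion (c : R -> C) (s t a b : R) :
  smooth1_C c -> c s <> RtoC 0 -> deriv_C c s <> RtoC 0 ->
  add2 (scal2 (RtoC a) (ds_C2 (orbit c c) s t)) (scal2 (RtoC b) (dt_C2 (orbit c c) s t)) = zero2 ->
  a = 0 /\ b = 0.
Proof.
intros Hc H0 H1.
rewrite (ds_orbit c c Hc Hc), dt_orbit; intro H; injection H; clear H.
fold (Cplus (a * (deriv_C c s * cis (- t))) (b * (- (Ci * c s) * cis (- t))))%C.
intros.
assert (E1 : (a * deriv_C c s + b * (Ci * c s))%C = RtoC 0).
{ apply Cmult_cis_eq0 with t.
  transitivity (a * (deriv_C c s * cis t) + b * (Ci * c s * cis t))%C; [ring|].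
  apply injective_projections; assumption. }
assert (E2 : (a * deriv_C c s - b * (Ci * c s))%C = RtoC 0).
{ apply Cmult_cis_eq0 with (- t).
  transitivity (a * (deriv_C c s * cis (- t)) + b * (- (Ci * c s) * cis (- t)))%C; [ring|].
  apply injective_projections; assumption. }
assert (HCi := Ci_nz).
split.
- assert (E : (RtoC a * (RtoC 2 * deriv_C c s))%C = RtoC 0).
  { transitivity ((a * deriv_C c s + b * (Ci * c s)) + (a * deriv_C c s - b * (Ci * c s)))%C; [ring|].
    rewrite E1, E2; ring. }
  destruct (Cmult_integral _ _ E) as [Ha | E']; [now apply RtoC_inj|].
  destruct (Cmult_integral _ _ E') as [E'' | E'']; [apply RtoC_inj in E''; lra|easy].
- assert (E : (RtoC b * (RtoC 2 * (Ci * c s)))%C = RtoC 0).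
  { transitivity ((a * deriv_C c s + b * (Ci * c s)) - (a * deriv_C c s - b * (Ci * c s)))%C; [ring|].
    rewrite E1, E2; ring. }
  destruct (Cmult_integral _ _ E) as [Ha | E']; [now apply RtoC_inj|].
  destruct (Cmult_integral _ _ E') as [E'' | E'']; [apply RtoC_inj in E''; lra|].
  destruct (Cmult_integral _ _ E'') as [E3 | E3]; easy.
Qed.

Lemma minimal_curvature (gamma : C -> Prop) (c : R -> C) (s : R) :
  minimal (L_of gamma) -> smooth1_C c -> (forall t, gamma (c t)) ->
  (forall t, c t <> RtoC 0) -> (forall t, deriv_C c t <> RtoC 0) ->
  let c1 := deriv_C c s in let c2 := deriv_C (deriv_C c) s in
  (1 + 2 * sqn (c s)) * sqn (c s) * cross c1 c2 =
  sqn c1 * cross (c s) c1 * (4 * sqn (c s) - 1).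
Proof.
intros Hm Hc Hg H0 H1; apply mean_curvature_orbit; auto.
apply Hm.
- now apply smooth2_C2_orbit.
- intros u t; exact (over_L_of gamma (c u) t (Hg u)).
- intros u t a b; now apply orbit_immersion.
Qed.

(** * Clairaut's first integral *)

Lemma mean_value (f df : R -> R) (s t : R) :
  (forall u, is_derive f u (df u)) -> exists u, f t - f s = df u * (t - s).
Proof.
intro Hf; destruct (MVT_gen f s t df) as [u [_ Hu]]; [| |now exists u].
- intros; apply Hf.
- intros u _; apply continuity_pt_filterlim, @ex_derive_continuous; exists (df u); apply Hf.
Qed.

Lemma is_derive_zero_const (f : R -> R) (s t : R) :
  (forall u, is_derive f u 0) -> f s = f t.
Proof.
intro Hf; destruct (mean_value f (fun _ => 0) s t Hf) as [u Hu]; lra.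
Qed.

(** The shape in which [auto_derive] leaves the derivatives of atoms. *)
Lemma Derive_eta (f : R -> R) (t l : R) : is_derive f t l -> Derive (fun u => f u) t = l.
Proof. apply is_derive_unique. Qed.

(** The square of Clairaut's first integral of the geodesics of the rotationally symmetric
    metric [rho / (1 + 2 rho)^3 |dz|^2], where [rho = |z|^2]. *)
Lemma clairaut (x y x1 y1 x2 y2 : R -> R) (s t : R)
  (rho := fun u => x u * x u + y u * y u)
  (N := fun u => x1 u * x1 u + y1 u * y1 u)
  (J := fun u => x u * y1 u - y u * x1 u) :
  (forall u, is_derive x u (x1 u)) -> (forall u, is_derive y u (y1 u)) ->
  (forall u, is_derive x1 u (x2 u)) -> (forall u, is_derive y1 u (y2 u)) ->
  (forall u, 0 < rho u) -> (forall u, 0 < N u) ->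
  (forall u, (1 + 2 * rho u) * rho u * (x1 u * y2 u - y1 u * x2 u) =
             N u * J u * (4 * rho u - 1)) ->
  J s ^ 2 * rho s / ((1 + 2 * rho s) ^ 3 * N s) =
  J t ^ 2 * rho t / ((1 + 2 * rho t) ^ 3 * N t).
Proof.
intros Dx Dy Dx1 Dy1 Hrho HN Hode.
apply (is_derive_zero_const (fun u => J u ^ 2 * rho u / ((1 + 2 * rho u) ^ 3 * N u))).
intro u; specialize (Hrho u); specialize (HN u); specialize (Hode u).
assert (DJ : is_derive J u (x u * y2 u - y u * x2 u)).
{ unfold J; auto_derive; [repeat split; eexists; auto|].
  rewrite (Derive_eta _ _ _ (Dx u)), (Derive_eta _ _ _ (Dy u)),
    (Derive_eta _ _ _ (Dx1 u)), (Derive_eta _ _ _ (Dy1 u)); ring. }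
assert (Drho : is_derive rho u (2 * (x u * x1 u + y u * y1 u))).
{ unfold rho; auto_derive; [repeat split; eexists; auto|].
  rewrite (Derive_eta _ _ _ (Dx u)), (Derive_eta _ _ _ (Dy u)); ring. }
assert (DN : is_derive N u (2 * (x1 u * x2 u + y1 u * y2 u))).
{ unfold N; auto_derive; [repeat split; eexists; auto|].
  rewrite (Derive_eta _ _ _ (Dx1 u)), (Derive_eta _ _ _ (Dy1 u)); ring. }
set (k := x1 u * y2 u - y1 u * x2 u) in *.
(* Decomposing the acceleration along and across the velocity replaces the second derivatives by [Q]
   and [k]. The equation then eliminates [k], and the derivative of the integral vanishes
   identically in [J], [rho], [N], [P] and [Q]. *)
assert (E : N u * (x u * y2 u - y u * x2 u) =
   (x1 u * x2 u + y1 u * y2 u) * J u + k * (x u * x1 u + y u * y1 u))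
  by (unfold N, J, k; ring).
set (P := x u * x1 u + y u * y1 u) in *; set (Q := x1 u * x2 u + y1 u * y2 u) in *.
set (J1 := x u * y2 u - y u * x2 u) in *.
clearbody J rho N k P Q J1; clear - DJ Drho DN Hrho HN Hode E.
auto_derive.
- repeat split; try (eexists; eassumption).
  apply Rgt_not_eq; repeat apply Rmult_lt_0_compat; lra.
- rewrite (Derive_eta _ _ _ DJ), (Derive_eta _ _ _ Drho), (Derive_eta _ _ _ DN).
  replace J1 with ((Q * J u + k * P) / N u) by (rewrite <- E; field; lra).
  replace k with (N u * J u * (4 * rho u - 1) / ((1 + 2 * rho u) * rho u))
    by (rewrite <- Hode; field; lra).
  field; lra.
Qed.

(** * Winding numbers of closed curves *)

(** If [v] never makes an angle of [PI / 2] or more with [u], the angle from [u]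
    to [v] is a single-valued arctangent. *)
Lemma is_RInt_angle_diff (a b a1 b1 p q p1 q1 : R -> R) :
  (forall t, is_derive a t (a1 t)) -> (forall t, is_derive b t (b1 t)) ->
  (forall t, is_derive p t (p1 t)) -> (forall t, is_derive q t (q1 t)) ->
  (forall t, ex_derive a1 t) -> (forall t, ex_derive b1 t) ->
  (forall t, ex_derive p1 t) -> (forall t, ex_derive q1 t) ->
  a 1 = a 0 -> b 1 = b 0 -> p 1 = p 0 -> q 1 = q 0 ->
  (forall t, 0 <= t <= 1 -> 0 < a t * p t + b t * q t) ->
  is_RInt (fun t => (p t * q1 t - q t * p1 t) / (p t * p t + q t * q t)
                  - (a t * b1 t - b t * a1 t) / (a t * a t + b t * b t)) 0 1 0.
Proof.
intros Da Db Dp Dq Ea1 Eb1 Ep1 Eq1 Ha Hb Hp Hq Hdot.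
set (F := fun t => atan ((a t * q t - b t * p t) / (a t * p t + b t * q t))).
assert (HF : F 1 - F 0 = 0) by (unfold F; rewrite Ha, Hb, Hp, Hq; ring).
refine (eq_ind (minus (F 1) (F 0)) (is_RInt _ 0 1) _ 0 HF).
apply (is_RInt_derive F).
all: rewrite Rmin_left, Rmax_right by lra; intros t Ht.
all: specialize (Hdot t Ht).
all: assert (Hsq : forall r k, r <> 0 \/ k <> 0 -> 0 < r * r + k * k)
  by (intros r k [H | H]; nra).
all: assert (Hu : 0 < a t * a t + b t * b t)
  by (apply Hsq, not_and_or; intros [E E']; rewrite E, E' in Hdot; lra).
all: assert (Hv : 0 < p t * p t + q t * q t)
  by (apply Hsq, not_and_or; intros [E E']; rewrite E, E' in Hdot; lra).
all: assert (Xa : ex_derive a t) by (eexists; apply Da).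
all: assert (Xb : ex_derive b t) by (eexists; apply Db).
all: assert (Xp : ex_derive p t) by (eexists; apply Dp).
all: assert (Xq : ex_derive q t) by (eexists; apply Dq).
- assert (DC : is_derive (fun t => a t * q t - b t * p t) t
      (a1 t * q t + a t * q1 t - (b1 t * p t + b t * p1 t))).
  { auto_derive; [repeat split; auto|].
    rewrite (Derive_eta _ _ _ (Da t)), (Derive_eta _ _ _ (Db t)),
      (Derive_eta _ _ _ (Dp t)), (Derive_eta _ _ _ (Dq t)); ring. }
  assert (DD : is_derive (fun t => a t * p t + b t * q t) t
      (a1 t * p t + a t * p1 t + (b1 t * q t + b t * q1 t))).
  { auto_derive; [repeat split; auto|].
    rewrite (Derive_eta _ _ _ (Da t)), (Derive_eta _ _ _ (Db t)),
      (Derive_eta _ _ _ (Dp t)), (Derive_eta _ _ _ (Dq t)); ring. }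
  assert (DF := is_derive_comp atan _ t _ _ (is_derive_atan _)
    (is_derive_div _ _ t _ _ DC DD (Rgt_not_eq _ _ Hdot))).
  unfold F; refine (eq_ind _ (is_derive _ t) DF _ _); clear DF DC DD.
  change scal with Rmult; cbv beta.
  match goal with |- ?l = ?r => change (@eq R l r) end.
  (* Differentiating the arctangent of [K / D] leaves the denominator [D^2 + K^2]. By Lagrange's
     identity this is the product of the squared lengths of the two vectors, which splits the
     fraction into their two angle forms. *)
  assert (E : (a t * a t + b t * b t) * (p t * p t + q t * q t) =
    (a t * p t + b t * q t) * (a t * p t + b t * q t) +
    (a t * q t - b t * p t) * (a t * q t - b t * p t)) by ring.
  transitivity
   (((a1 t * q t + a t * q1 t - (b1 t * p t + b t * p1 t)) * (a t * p t + b t * q t) -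
     (a t * q t - b t * p t) * (a1 t * p t + a t * p1 t + (b1 t * q t + b t * q1 t))) /
    ((a t * a t + b t * b t) * (p t * p t + q t * q t))).
  + rewrite E; clear E Hu Hv; revert Hdot.
    generalize (a t * p t + b t * q t) (a t * q t - b t * p t); intros D K HD.
    assert (0 < D * D) by (apply Rmult_lt_0_compat; lra).
    assert (0 <= K * K) by apply Rle_0_sqr.
    unfold Rsqr. field; split; lra.
  + clear E. field; split; apply Rgt_not_eq; assumption.
- apply @ex_derive_continuous; auto_derive. repeat split; auto. all: apply Rgt_not_eq; assumption.
Qed.

(** The pullback along [c] of the differential of the polar angle centred at [P]. *)
Definition angle_form (c : R -> C) (P : C) (t : R) : R :=
  cross (c t - P)%C (deriv_C c t) / sqn (c t - P)%C.

Lemma is_derive_Re (c : R -> C) (P : C) (t : R) :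
  smooth1_C c -> is_derive (fun u => Re (c u - P)%C) t (Re (deriv_C c t)).
Proof.
intros [H _]; simpl.
apply (is_derive_ext (fun u => plus (Re (c u)) (Re (- P)%C))); [reflexivity|].
rewrite <- (plus_zero_r (Derive _ _)).
apply @is_derive_plus; [|apply @is_derive_const].
apply Derive_correct, smooth1_R_ex_derive, H.
Qed.

Lemma is_derive_Im (c : R -> C) (P : C) (t : R) :
  smooth1_C c -> is_derive (fun u => Im (c u - P)%C) t (Im (deriv_C c t)).
Proof.
intros [_ H]; simpl.
apply (is_derive_ext (fun u => plus (Im (c u)) (Im (- P)%C))); [reflexivity|].
rewrite <- (plus_zero_r (Derive _ _)).
apply @is_derive_plus; [|apply @is_derive_const].
apply Derive_correct, smooth1_R_ex_derive, H.
Qed.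

Lemma ex_derive_Re (c : R -> C) (t : R) : smooth1_C c -> ex_derive (fun u => Re (c u)) t.
Proof. intros [H _]; now apply smooth1_R_ex_derive. Qed.

Lemma ex_derive_Im (c : R -> C) (t : R) : smooth1_C c -> ex_derive (fun u => Im (c u)) t.
Proof. intros [_ H]; now apply smooth1_R_ex_derive. Qed.

Lemma sqn_eq0 (z : C) : sqn z = 0 -> z = RtoC 0.
Proof.
intro H; apply NNPP; intro Hz; assert (E := sqn_pos z Hz); lra.
Qed.

Lemma ex_derive_angle (f g h k : R -> R) (t : R) :
  ex_derive f t -> ex_derive g t -> ex_derive h t -> ex_derive k t ->
  f t * f t + g t * g t <> 0 ->
  ex_derive (fun u => (f u * k u - g u * h u) / (f u * f u + g u * g u)) t.
Proof. intros; auto_derive; repeat split; assumption. Qed.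

Lemma angle_form_continuous (c : R -> C) (P : C) (t : R) :
  smooth1_C c -> c t <> P -> continuous (angle_form c P) t.
Proof.
intros Hc HP; apply @ex_derive_continuous.
refine (ex_derive_angle (fun u => Re (c u - P)%C) (fun u => Im (c u - P)%C)
  (fun u => Re (deriv_C c u)) (fun u => Im (deriv_C c u)) t _ _ _ _ _).
- eexists; apply (is_derive_Re c P t Hc).
- eexists; apply (is_derive_Im c P t Hc).
- apply (ex_derive_Re _ t (smooth1_C_deriv c Hc)).
- apply (ex_derive_Im _ t (smooth1_C_deriv c Hc)).
- intro E; apply HP; apply sqn_eq0 in E.
  transitivity (c t - P + P)%C; [ring|rewrite E; ring].
Qed.

Definition dot (z w : C) : R := Re z * Re w + Im z * Im w.

(** [2 PI] times the winding number. *)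
Definition winding (c : R -> C) (P : C) : R := RInt (angle_form c P) 0 1.

Lemma dot_pos_neq (c : R -> C) (P z : C) (t : R) : 0 < dot (c t - P)%C z -> c t <> P.
Proof.
intros H E; rewrite E in H.
replace (P - P)%C with (RtoC 0) in H by ring.
unfold dot, Re, Im, RtoC in H; simpl in H; lra.
Qed.

Lemma is_RInt_winding (c : R -> C) (P : C) :
  smooth1_C c -> (forall t, 0 <= t <= 1 -> c t <> P) ->
  is_RInt (angle_form c P) 0 1 (winding c P).
Proof.
intros Hc HP; apply @RInt_correct, @ex_RInt_continuous.
rewrite Rmin_left, Rmax_right by lra; intros t Ht.
now apply angle_form_continuous; auto.
Qed.

Lemma dotC (z w : C) : dot z w = dot w z.
Proof. unfold dot; ring. Qed.

(** The vectors from [P] and from [Q] to the moving point always make an acute angle, so the angle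
    between them is single-valued and returns to its initial value when the curve closes up. *)
Lemma winding_eq (c : R -> C) (P Q : C) :
  smooth1_C c -> c 1 = c 0 ->
  (forall t, 0 <= t <= 1 -> 0 < dot (c t - P)%C (c t - Q)%C) ->
  winding c P = winding c Q.
Proof.
intros Hc Hp Hdot.
assert (HP : forall t, 0 <= t <= 1 -> c t <> P)
  by (intros t Ht; eapply dot_pos_neq, Hdot, Ht).
assert (HQ : forall t, 0 <= t <= 1 -> c t <> Q)
  by (intros t Ht; eapply dot_pos_neq; rewrite dotC; apply Hdot, Ht).
assert (H1 := is_RInt_angle_diff
  (fun t => Re (c t - P)%C) (fun t => Im (c t - P)%C)
  (fun t => Re (deriv_C c t)) (fun t => Im (deriv_C c t))
  (fun t => Re (c t - Q)%C) (fun t => Im (c t - Q)%C)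
  (fun t => Re (deriv_C c t)) (fun t => Im (deriv_C c t))
  (fun t => is_derive_Re c P t Hc) (fun t => is_derive_Im c P t Hc)
  (fun t => is_derive_Re c Q t Hc) (fun t => is_derive_Im c Q t Hc)
  (fun t => ex_derive_Re _ t (smooth1_C_deriv c Hc))
  (fun t => ex_derive_Im _ t (smooth1_C_deriv c Hc))
  (fun t => ex_derive_Re _ t (smooth1_C_deriv c Hc))
  (fun t => ex_derive_Im _ t (smooth1_C_deriv c Hc))
  (f_equal (fun z => Re (z - P)%C) Hp) (f_equal (fun z => Im (z - P)%C) Hp)
  (f_equal (fun z => Re (z - Q)%C) Hp) (f_equal (fun z => Im (z - Q)%C) Hp) Hdot).
assert (H2 := is_RInt_minus _ _ 0 1 _ _ (is_RInt_winding c Q Hc HQ) (is_RInt_winding c P Hc HP)).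
assert (E := eq_trans (eq_sym (is_RInt_unique _ _ _ _ H1)) (is_RInt_unique _ _ _ _ H2)).
unfold minus, plus, opp in E; simpl in E; lra.
Qed.

(** The comparison is now with the constant vector [- P], which does not turn: seen from [P], the
    curve stays in an open half-plane. *)
Lemma winding_far (c : R -> C) (P : C) :
  smooth1_C c -> c 1 = c 0 ->
  (forall t, 0 <= t <= 1 -> 0 < dot (c t - P)%C (- P)%C) ->
  winding c P = 0.
Proof.
intros Hc Hp Hdot.
assert (HP : forall t, 0 <= t <= 1 -> c t <> P)
  by (intros t Ht; eapply dot_pos_neq, Hdot, Ht).
assert (D0 : forall k t : R, is_derive (fun _ => k) t 0) by (intros; apply @is_derive_const).
assert (E0 : forall t : R, ex_derive (fun _ => 0) t) by (intros; apply @ex_derive_const).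
assert (H1 := is_RInt_angle_diff
  (fun t => Re (c t - P)%C) (fun t => Im (c t - P)%C)
  (fun t => Re (deriv_C c t)) (fun t => Im (deriv_C c t))
  (fun _ => Re (- P)%C) (fun _ => Im (- P)%C) (fun _ => 0) (fun _ => 0)
  (fun t => is_derive_Re c P t Hc) (fun t => is_derive_Im c P t Hc) (D0 _) (D0 _)
  (fun t => ex_derive_Re _ t (smooth1_C_deriv c Hc))
  (fun t => ex_derive_Im _ t (smooth1_C_deriv c Hc)) E0 E0
  (f_equal (fun z => Re (z - P)%C) Hp) (f_equal (fun z => Im (z - P)%C) Hp)
  eq_refl eq_refl Hdot).
assert (H2 := is_RInt_opp _ 0 1 _ (is_RInt_winding c P Hc HP)).
apply (is_RInt_ext _ (fun t => opp (angle_form c P t))) in H1.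
- assert (E := eq_trans (eq_sym (is_RInt_unique _ _ _ _ H1)) (is_RInt_unique _ _ _ _ H2)).
  unfold opp in E; simpl in E; lra.
- intros t _; unfold angle_form, opp, cross, sqn; simpl; unfold Rdiv; ring.
Qed.

Lemma continuous_Re (p : R -> C) (t : R) : continuous p t -> continuous (fun u => Re (p u)) t.
Proof. intro H; exact (continuous_comp p fst t H (continuous_fst (fst (p t)) (snd (p t)))). Qed.

Lemma continuous_Im (p : R -> C) (t : R) : continuous p t -> continuous (fun u => Im (p u)) t.
Proof. intro H; exact (continuous_comp p snd t H (continuous_snd (fst (p t)) (snd (p t)))). Qed.

Lemma sqn_continuous (c : R -> C) (P : C) (t : R) :
  smooth1_C c -> continuity_pt (fun t => sqn (c t - P)%C) t.
Proof.
intro Hc; apply continuity_pt_filterlim, @ex_derive_continuous.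
assert (H : forall f g : R -> R, ex_derive f t -> ex_derive g t ->
    ex_derive (fun u => f u * f u + g u * g u) t)
  by (intros; auto_derive; repeat split; assumption).
apply (H (fun u => Re (c u - P)%C) (fun u => Im (c u - P)%C)).
- eexists; apply (is_derive_Re c P t Hc).
- eexists; apply (is_derive_Im c P t Hc).
Qed.

Lemma winding_locally_constant (c : R -> C) (P : C) :
  smooth1_C c -> c 1 = c 0 -> (forall t, 0 <= t <= 1 -> c t <> P) ->
  exists eps : posreal, forall Q,
    Rabs (Re Q - Re P) < eps -> Rabs (Im Q - Im P) < eps ->
    winding c P = winding c Q.
Proof.
intros Hc Hp HP.
destruct (continuity_ab_min (fun t => sqn (c t - P)%C) 0 1) as [m [Hmin Hm]];
  [lra|intros; now apply sqn_continuous|].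
assert (Hpos : 0 < sqn (c m - P)%C).
{ apply sqn_pos; intro E; apply (HP m Hm).
  transitivity (c m - P + P)%C; [ring|rewrite E; ring]. }
(* Half the distance from [P] to the curve. *)
assert (Heps : 0 < sqrt (sqn (c m - P)%C) / 2) by (apply sqrt_lt_R0 in Hpos; lra).
exists (mkposreal _ Heps); simpl; intros Q H1 H2.
apply winding_eq; auto; intros t Ht; specialize (Hmin t Ht); simpl in Hmin.
assert (Hr := sqrt_sqrt _ (Rlt_le _ _ Hpos)).
set (r := sqrt _) in *.
apply Rabs_def2 in H1; apply Rabs_def2 in H2.
rewrite <- Hr in Hmin; clear Hr.
destruct (c t) as [x y], P as [a b], Q as [d e].
unfold dot, sqn, Cminus, Copp, Cplus, Re, Im in *; simpl in *.
(* Twice the dot product equals [|c - P|^2 + |c - Q|^2 - |P - Q|^2]. The first term is at least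
   [r^2], and the last is below [r^2 / 2] because each coordinate of [Q - P] is below [r / 2]. *)
assert (Hd : 0 < (r / 2 - (d - a)) * (r / 2 + (d - a))) by (apply Rmult_lt_0_compat; lra).
assert (He : 0 < (r / 2 - (e - b)) * (r / 2 + (e - b))) by (apply Rmult_lt_0_compat; lra).
assert (Hr : 0 < r * r) by (apply Rmult_lt_0_compat; lra).
assert (Hx := Rle_0_sqr (x - d)); assert (Hy := Rle_0_sqr (y - e)); unfold Rsqr in *.
lra.
Qed.

(** As a function of time along the path, the winding number is locally constant, hence has zero
    derivative. *)
Lemma winding_path (c p : R -> C) :
  smooth1_C c -> c 1 = c 0 -> (forall t, continuous p t) ->
  (forall t s, 0 <= t <= 1 -> 0 <= s <= 1 -> c t <> p s) ->
  winding c (p 0) = winding c (p 1).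
Proof.
intros Hc Hp Hcont Havoid.
(* Precomposing with [sin ^ 2] keeps the path in [0, 1] for all real times. *)
set (q := fun u => p (Rsqr (sin u))).
assert (Hq : forall u, continuous q u).
{ intro u; unfold q; apply (continuous_comp (fun u => Rsqr (sin u)) p); [|apply Hcont].
  apply @ex_derive_continuous; unfold Rsqr; auto_derive; exact I. }
assert (Hrange : forall u, 0 <= Rsqr (sin u) <= 1).
{ intro u; assert (E := sin2_cos2 u); assert (E1 := Rle_0_sqr (sin u)).
  assert (E2 := Rle_0_sqr (cos u)); lra. }
assert (E : winding c (q 0) = winding c (q (PI / 2))).
{ apply (is_derive_zero_const (fun u => winding c (q u))); intro u.
  destruct (winding_locally_constant c (q u) Hc Hp) as [eps Heps].
  { intros t Ht; apply Havoid; auto. }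
  apply (is_derive_ext_loc (fun _ => winding c (q u))); [|apply @is_derive_const].
  generalize (filter_and _ _
    (proj1 (filterlim_locally _ _) (continuous_Re q u (Hq u)) eps)
    (proj1 (filterlim_locally _ _) (continuous_Im q u (Hq u)) eps)).
  apply filter_imp; intros v [H1 H2]; apply Heps; [exact H1|exact H2]. }
unfold q in E; rewrite sin_0, sin_PI2 in E; unfold Rsqr in E.
now rewrite Rmult_0_l, Rmult_1_l in E.
Qed.

(** * The two contradictory values of the winding number around 0 *)

Lemma nonzero_constant_sign (f : R -> R) :
  (forall t, continuity_pt f t) -> (forall t, f t <> 0) ->
  (forall t, 0 < f t) \/ (forall t, f t < 0).
Proof.
intros Hc Hn.
destruct (Rtotal_order (f 0) 0) as [H0 | [H0 | H0]]; [|now destruct (Hn 0)|];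
  [right|left]; intro t; apply Rnot_le_lt; intro Ht;
  (destruct (IVT_gen f 0 t 0) as [u [_ Hu]]; [exact Hc| |now destruct (Hn u)]).
- rewrite Rmin_left, Rmax_right; lra.
- rewrite Rmin_right, Rmax_left; lra.
Qed.

Lemma sqn_Cmod (z : C) : sqn z = Cmod z * Cmod z.
Proof.
unfold Cmod; rewrite sqrt_sqrt.
- unfold sqn, Re, Im; ring.
- apply Rplus_le_le_0_compat; apply pow2_ge_0.
Qed.

Lemma winding_not_enclosed (gamma0 : C -> Prop) (c : R -> C) :
  smooth1_C c -> c 1 = c 0 -> (forall t, gamma0 (c t)) ->
  ~ gamma0 (RtoC 0) -> ~ encloses gamma0 (RtoC 0) ->
  winding c (RtoC 0) = 0.
Proof.
intros Hc Hp Hg H0 Henc.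
destruct (continuity_ab_maj (fun t => sqn (c t - RtoC 0)%C) 0 1) as [m [Hmax _]];
  [lra|intros; now apply sqn_continuous|].
(* The largest modulus on the curve is tried as the bound in [encloses]. Its failure gives a path
   from 0, avoiding [gamma0], that ends outside the smallest disc centred at 0 containing the
   curve. *)
assert (Hex : exists p : R -> C, (forall t, continuous p t) /\ p 0 = RtoC 0 /\
    (forall t, 0 <= t <= 1 -> ~ gamma0 (p t)) /\ Cmod (c m) < Cmod (p 1)).
{ apply NNPP; intro Hn; apply Henc; split; [exact H0|].
  exists (Cmod (c m)); intros p P1 P2 P3; apply Rnot_lt_le; intro P4.
  apply Hn; now exists p. }
destruct Hex as [p [P1 [P2 [P3 P4]]]].
rewrite <- P2, (winding_path c p Hc Hp P1).
- apply winding_far; auto; intros t Ht; specialize (Hmax t Ht); simpl in Hmax.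
  assert (Hlt : sqn (c m - RtoC 0)%C < sqn (p 1)).
  { replace (c m - RtoC 0)%C with (c m) by ring; rewrite !sqn_Cmod.
    apply Rmult_le_0_lt_compat; auto using Cmod_ge_0. }
  assert (Hlt' := Rle_lt_trans _ _ _ Hmax Hlt); clear - Hlt'.
  destruct (c t) as [x y], (p 1) as [a b].
  unfold dot, sqn, Cminus, Copp, Cplus, Re, Im, RtoC in *; simpl in *.
  (* With [P = p 1], twice the dot product is [|c - P|^2 + |P|^2 - |c|^2], and [|c| < |P|]. *)
  assert (Hx := Rle_0_sqr (x - a)); assert (Hy := Rle_0_sqr (y - b)); unfold Rsqr in *.
  lra.
- intros t s _ Hs E; apply (P3 s Hs); rewrite <- E; apply Hg.
Qed.

(** A zero of [cross] at [t] would make Clairaut's constant zero, whereas it is positive where the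
    position and the velocity are orthogonal. *)
Lemma cross_neq0 (c : R -> C) :
  smooth1_C c -> c 1 = c 0 ->
  (forall t, c t <> RtoC 0) -> (forall t, deriv_C c t <> RtoC 0) ->
  (forall s, let c1 := deriv_C c s in let c2 := deriv_C (deriv_C c) s in
    (1 + 2 * sqn (c s)) * sqn (c s) * cross c1 c2 =
    sqn c1 * cross (c s) c1 * (4 * sqn (c s) - 1)) ->
  forall t, cross (c t) (deriv_C c t) <> 0.
Proof.
intros Hc Hp H0 H1 Hode t Ht.
assert (Dx : forall u, is_derive (fun u => Re (c u)) u (Re (deriv_C c u)))
  by (intro; now apply Derive_correct, ex_derive_Re).
assert (Dy : forall u, is_derive (fun u => Im (c u)) u (Im (deriv_C c u)))
  by (intro; now apply Derive_correct, ex_derive_Im).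
assert (Hc1 := smooth1_C_deriv c Hc).
(* Rolle's theorem for [sqn (c u)], which takes the same value at 0 and 1 and has twice this [dot]
   as derivative. *)
assert (Hrolle : exists s, dot (c s) (deriv_C c s) = 0).
{ assert (Dsq : forall f g f1 g1 : R -> R, (forall u, is_derive f u (f1 u)) ->
      (forall u, is_derive g u (g1 u)) ->
      forall u, is_derive (fun u => f u * f u + g u * g u) u (2 * (f u * f1 u + g u * g1 u))).
  { intros f g f1 g1 Df Dg u; assert (Xf := ex_intro _ _ (Df u) : ex_derive f u).
    assert (Xg := ex_intro _ _ (Dg u) : ex_derive g u).
    auto_derive; [repeat split; assumption|].
    rewrite (Derive_eta _ _ _ (Df u)), (Derive_eta _ _ _ (Dg u)); ring. }
  assert (Drho := Dsq _ _ _ _ Dx Dy).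
  destruct (mean_value _ _ 0 1 Drho) as [s Hs].
  exists s; rewrite Hp in Hs; unfold dot; lra. }
destruct Hrolle as [s Hs].
assert (HK := clairaut _ _ _ _ _ _ s t Dx Dy
  (fun u => Derive_correct _ u (ex_derive_Re _ u Hc1))
  (fun u => Derive_correct _ u (ex_derive_Im _ u Hc1))
  (fun u => sqn_pos _ (H0 u)) (fun u => sqn_pos _ (H1 u)) Hode).
cbv beta in HK.
change ((cross (c s) (deriv_C c s)) ^ 2 * sqn (c s) / ((1 + 2 * sqn (c s)) ^ 3 * sqn (deriv_C c s))
 = (cross (c t) (deriv_C c t)) ^ 2 * sqn (c t) / ((1 + 2 * sqn (c t)) ^ 3 * sqn (deriv_C c t))) in HK.
rewrite Ht in HK.
assert (Hrho := sqn_pos _ (H0 s)); assert (HN := sqn_pos _ (H1 s)).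
(* Lagrange's identity at a point where [dot] vanishes. *)
assert (HJ : cross (c s) (deriv_C c s) ^ 2 = sqn (c s) * sqn (deriv_C c s)).
{ rewrite <- (Rminus_0_r (_ ^ 2)); rewrite <- (Rmult_0_l (- dot (c s) (deriv_C c s))).
  rewrite <- Hs at 1; unfold cross, dot, sqn; ring. }
rewrite HJ in HK.
assert (Hpos : 0 < sqn (c s) * sqn (deriv_C c s) * sqn (c s) / ((1 + 2 * sqn (c s)) ^ 3 * sqn (deriv_C c s))).
{ apply Rdiv_lt_0_compat; repeat apply Rmult_lt_0_compat; try apply pow_lt; lra. }
rewrite HK in Hpos; unfold Rdiv in Hpos; rewrite pow_i, !Rmult_0_l in Hpos; [lra|auto].
Qed.

(** The angle form is continuous without zeros, so it keeps one sign and so does its integral. *)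
Lemma winding_neq0 (c : R -> C) :
  smooth1_C c -> (forall t, c t <> RtoC 0) ->
  (forall t, cross (c t) (deriv_C c t) <> 0) ->
  winding c (RtoC 0) <> 0.
Proof.
intros Hc H0 HJ.
assert (Hcont : forall t, continuous (angle_form c (RtoC 0)) t)
  by (intro; now apply angle_form_continuous).
assert (Hz : forall z, (z - RtoC 0)%C = z) by (intro; ring).
assert (Hn : forall t, angle_form c (RtoC 0) t <> 0).
{ intro t; unfold angle_form; rewrite Hz.
  apply Rmult_integral_contrapositive_currified; [apply HJ|].
  apply Rinv_neq_0_compat, Rgt_not_eq, sqn_pos, H0. }
destruct (nonzero_constant_sign (angle_form c (RtoC 0))) as [H | H]; auto.
- intro; apply continuity_pt_filterlim, Hcont.
- apply Rgt_not_eq, RInt_gt_0; auto; lra.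
- apply Rlt_not_eq.
  assert (E : 0 < RInt (fun t => opp (angle_form c (RtoC 0) t)) 0 1).
  { apply RInt_gt_0; [lra| |intros; now apply @continuous_opp].
    intros t _; specialize (H t); unfold opp; simpl; lra. }
  assert (E1 := is_RInt_unique _ _ _ _
    (is_RInt_opp _ 0 1 _ (is_RInt_winding c (RtoC 0) Hc (fun t _ => H0 t)))).
  unfold opp in *; simpl in *; lra.
Qed.

Theorem proposition5p9 :
  ~ exists L : CP2 -> Prop, equivariant_Chekanov_torus L /\ minimal L.
Proof.
intros [L [[gamma [gamma0 [-> [_ [_ [Hgamma [[c [Hc [Hper [Hc1 [_ Himg]]]]] [H0 [Henc _]]]]]]]]] Hmin]].
assert (Hg : forall t, gamma0 (c t)) by (intro t; apply Himg; now exists t).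
assert (Hp : c 1 = c 0) by (rewrite <- (Rplus_0_l 1); apply Hper).
assert (Hc0 : forall t, c t <> RtoC 0) by (intros t E; apply H0; rewrite <- E; apply Hg).
apply (winding_neq0 c Hc Hc0); [|now apply winding_not_enclosed with gamma0].
apply cross_neq0; auto.
intro s; apply minimal_curvature with gamma; auto.
intro t; apply Hgamma; left; apply Hg.
Qed.
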